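(* Let $\mathcal{D}\subseteq\mathbb{R}^d$ be a convex decision set and let $f_1,\ldots,f_T:\mathcal{D}\to\mathbb{R}$ be loss functions, each $H$-strongly convex on $\mathcal{D}$ and satisfying $|f_t(\boldsymbol x)-f_t(\boldsymbol y)|\le G\|\boldsymbol x-\boldsymbol y\|$ for all $\boldsymbol x,\boldsymbol y\in\mathcal{D}$. Run FLH with learning rate $\zeta=H/G^2$, where the base learner $E^j$ ($j=1,\ldots,T$) is an instance of online gradient descent (projected onto $\mathcal{D}$) with step size $\eta_t=1/(Ht)$ started at time $j$. Then for every comparator sequence $\boldsymbol z_1,\ldots,\boldsymbol z_T\in\mathcal{D}$ the predictions $\boldsymbol x_t$ of FLH satisfy $$\sum_{t=1}^T\big(f_t(\boldsymbol x_t)-f_t(\boldsymbol z_t)\big)=\tilde O\big(\sqrt{TV_T}\vee 1\big),$$ where $V_T=\sum_{t=2}^T\|\boldsymbol z_t-\boldsymbol z_{t-1}\|$, $a\vee b=\max\{a,b\}$, and $\tilde O(\cdot)$ hides dependence on $H,G$ and polylogarithmic factors of $T$. The algorithm does not need to know $V_T$.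
   Context: Online convex optimization: at each round $t=1,\ldots,T$ the learner picks $\boldsymbol x_t\in\mathcal{D}$, then the adversary reveals a convex loss $f_t$. $f$ is $H$-strongly convex on $\mathcal{D}$ if $f(\boldsymbol y)\ge f(\boldsymbol x)+(\boldsymbol y-\boldsymbol x)^T\nabla f(\boldsymbol x)+\frac H2\|\boldsymbol x-\boldsymbol y\|^2$ for all $\boldsymbol x,\boldsymbol y\in\mathcal{D}$. $\|\cdot\|$ is the Euclidean norm. FLH (Follow-the-Leading-History) with learning rate $\zeta$ and base learners $E^1,\ldots,E^T$: maintain a probability vector $v_t\in\mathbb{R}^t$ with $v_1^{(1)}=1$; at round $t$ let $x_t^{(j)}$ be the prediction of $E^j$ for $j\le t$ and play $x_t=\sum_{j=1}^t v_t^{(j)}x_t^{(j)}$; after observing $f_t$ set $\hat v_{t+1}^{(i)}=v_t^{(i)}e^{-\zeta f_t(x_t^{(i)})}/\sum_{j=1}^t v_t^{(j)}e^{-\zeta f_t(x_t^{(j)})}$ for $i\le t$, then set $v_{t+1}^{(t+1)}=1/(t+1)$ and $v_{t+1}^{(i)}=(1-(t+1)^{-1})\hat v_{t+1}^{(i)}$ for $i\le t$. *)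

(* Defs.v *)
From HB Require Import structures.
From mathcomp Require Import all_boot all_order all_algebra.
From mathcomp Require Import all_classical all_reals all_analysis.
Set Implicit Arguments. Unset Strict Implicit. Unset Printing Implicit Defensive.
Import Order.TTheory GRing.Theory Num.Theory.
Import numFieldNormedType.Exports.
Local Open Scope classical_set_scope.
Local Open Scope ring_scope.

Section FLH.
Variable R : realType.
Variable d : nat.
Notation vec := 'rV[R]_d.

(* Euclidean inner product and Euclidean norm on R^d (the library norm on
   matrices is the sup norm, so we define the Euclidean one explicitly). *)
Definition dotv (u v : vec) : R := \sum_(i < d) u 0 i * v 0 i.
Definition enorm (v : vec) : R := Num.sqrt (dotv v v).

Definition gradv (f : vec -> R) (x : vec) : vec :=
  \row_(i < d) derive f x (delta_mx 0 i).

Definition is_convex_set (D : set vec) : Prop :=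
  forall x y (l : R), D x -> D y -> 0 <= l <= 1 -> D (l *: x + (1 - l) *: y).

Definition strongly_convex_on (D : set vec) (H : R) (f : vec -> R) : Prop :=
  forall x y, D x -> D y ->
    f x + dotv (y - x) (gradv f x) + H / 2 * enorm (x - y) ^+ 2 <= f y.

Definition glipschitz_on (D : set vec) (G : R) (f : vec -> R) : Prop :=
  forall x y, D x -> D y -> `|f x - f y| <= G * enorm (x - y).

(* Euclidean projection onto D: a nearest point of D (unique when D is
   nonempty, closed and convex); default y if none exists. *)
Definition eproj (D : set vec) (y : vec) : vec :=
  xget y [set x | D x /\ forall w, D w -> enorm (x - y) <= enorm (w - y)].

Variables (D : set vec) (H G : R) (f : nat -> vec -> R) (init : nat -> vec).

(* Base learner E^j: OGD started at time j from init j, step size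
   1/(H k) at its k-th update (k = t - j + 1 at time t).
   ogd j n = prediction of E^j at time j + n. *)
Fixpoint ogd (j n : nat) : vec :=
  match n with
  | 0 => init j
  | n'.+1 => eproj D (ogd j n' - (H * n'.+1%:R)^-1 *: gradv (f (j + n')%N) (ogd j n'))
  end.

(* prediction of E^j at time t (meaningful for j <= t) *)
Definition base (j t : nat) : vec := ogd j (t - j).

Definition zeta : R := H / G ^+ 2.

Fixpoint flh_w (t : nat) : nat -> R :=
  match t with
  | 0 => fun _ => 0
  | s.+1 =>
    if s == 0%N then (fun i => if i == 1%N then 1 else 0)
    else
      let p := flh_w s in
      let Z := \sum_(1 <= j < s.+1) p j * expR (- zeta * f s (base j s)) in
      fun i => if i == s.+1 then (s.+1%:R)^-1
               else if (1 <= i <= s)%N then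
                 (1 - (s.+1%:R)^-1) * (p i * expR (- zeta * f s (base i s)) / Z)
               else 0
  end.

Definition flh_x (t : nat) : vec := \sum_(1 <= j < t.+1) flh_w t j *: base j t.

End FLH.

Definition regret (R : realType) d (D : set 'rV[R]_d) (H G : R)
  (f : nat -> 'rV[R]_d -> R) (init : nat -> 'rV[R]_d) (z : nat -> 'rV[R]_d)
  (T : nat) : R :=
  \sum_(1 <= t < T.+1) (f t (flh_x D H G f init t) - f t (z t)).

Definition path_length (R : realType) d (z : nat -> 'rV[R]_d) (T : nat) : R :=
  \sum_(2 <= t < T.+1) enorm (z t - z t.-1).

(* Main.v *)
Require Import Defs.
From HB Require Import structures.
From mathcomp Require Import all_boot all_order all_algebra.
From mathcomp Require Import all_classical all_reals all_analysis.
From mathcomp Require Import ring lra zify.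
Set Implicit Arguments. Unset Strict Implicit. Unset Printing Implicit Defensive.
Import Order.TTheory GRing.Theory Num.Theory.
Import numFieldNormedType.Exports.
Local Open Scope classical_set_scope.
Local Open Scope ring_scope.

(** On an interval [a, b) and against a fixed comparator, FLH competes with the
    base learner started at time a. With zeta = H / G^2 the losses are
    zeta-exp-concave, so by Jensen exp(zeta * regret against E^a) is at most the
    ratio of b * v_b^(a) to a * v_a^(a) = 1, and v_b^(a) <= 1 bounds that regret
    by ln b / zeta; the learner E^a itself is online gradient descent on strongly
    convex losses, with logarithmic static regret. Static regret is thus
    O(1 + ln T) on every interval. Cutting [1, T] into about 2M blocks, where
    M = max(sqrt(T V), 1), and comparing in each block with its first comparator
    costs O(M (1 + ln T)) of static regret and a drift of at most
    G (T / M) V <= G M. *)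

(** * Euclidean geometry of R^d and projection onto a closed convex set *)

Section Euclid.
Context {R : realType} {d : nat}.
Implicit Types (u v w : 'rV[R]_d) (a l : R).

Lemma dotvC u v : dotv u v = dotv v u.
Proof. by apply: eq_bigr => i _; rewrite mulrC. Qed.

Lemma dotvDl u v w : dotv (u + v) w = dotv u w + dotv v w.
Proof. by rewrite -big_split; apply: eq_bigr => i _; rewrite !mxE mulrDl. Qed.

Lemma dotvZl a u v : dotv (a *: u) v = a * dotv u v.
Proof. by rewrite /dotv mulr_sumr; apply: eq_bigr => i _; rewrite !mxE mulrA. Qed.

Lemma dotvNl u v : dotv (- u) v = - dotv u v.
Proof. by rewrite -scaleN1r dotvZl mulN1r. Qed.

Lemma dotvDr u v w : dotv w (u + v) = dotv w u + dotv w v.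
Proof. by rewrite dotvC dotvDl !(dotvC w). Qed.

Lemma dotvZr a u v : dotv u (a *: v) = a * dotv u v.
Proof. by rewrite dotvC dotvZl dotvC. Qed.

Lemma dotvNr u v : dotv u (- v) = - dotv u v.
Proof. by rewrite dotvC dotvNl dotvC. Qed.

Definition dotvE := (dotvDl, dotvDr, dotvNl, dotvNr, dotvZl, dotvZr).

Lemma dotv_sumr (I : Type) (r : seq I) (P : pred I) (F : I -> 'rV[R]_d) u :
  dotv u (\sum_(i <- r | P i) F i) = \sum_(i <- r | P i) dotv u (F i).
Proof.
elim/big_rec2: _ => [|i y x _ <-]; last by rewrite dotvDr.
by rewrite -(scale0r 0) dotvZr mul0r.
Qed.

Lemma dotvv_ge0 v : 0 <= dotv v v.
Proof. by apply: sumr_ge0 => i _; rewrite -expr2 sqr_ge0. Qed.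

Lemma enorm_ge0 v : 0 <= enorm v.
Proof. exact: sqrtr_ge0. Qed.

Lemma sqr_enorm v : enorm v ^+ 2 = dotv v v.
Proof. by rewrite sqr_sqrtr // dotvv_ge0. Qed.

Lemma ler_enorm u v : (enorm u <= enorm v) = (dotv u u <= dotv v v).
Proof. by rewrite ler_sqrt // dotvv_ge0. Qed.

Lemma enormN v : enorm (- v) = enorm v.
Proof. by rewrite /enorm !dotvE opprK. Qed.

Lemma enormB u v : enorm (u - v) = enorm (v - u).
Proof. by rewrite -enormN opprB. Qed.

Lemma enorm0 : enorm (0 : 'rV[R]_d) = 0.
Proof. by rewrite /enorm -(scale0r 0) dotvZl mul0r sqrtr0. Qed.

Lemma coord_le_enorm v i : `|v 0 i| <= enorm v.
Proof.
rewrite -sqrtr_sqr ler_wsqrtr // /dotv (bigD1 i) //= -expr2 lerDl.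
by apply: sumr_ge0 => j _; rewrite -expr2 sqr_ge0.
Qed.

(** With x and y the norms of [u] and [v], the vector [y *: u - x *: v] has squared norm 2xy(xy -
    [dotv u v]). This settles the case xy > 0; otherwise one of the vectors has zero coordinates. *)
Lemma dotv_cauchy u v : dotv u v <= enorm u * enorm v.
Proof.
have := dotvv_ge0 (enorm v *: u - enorm u *: v).
rewrite !dotvE -!sqr_enorm (dotvC v u).
have := enorm_ge0 u; have := enorm_ge0 v.
set x := enorm u; set y := enorm v; set c := dotv u v => y0 x0 h.
have {}h : 0 <= x * y * (x * y - c) by nra.
have [xy0|] := ltP 0 (x * y); first by rewrite -subr_ge0 -(pmulr_rge0 _ xy0).
move=> xy0; have {h}: x * y = 0 by apply/eqP; rewrite eq_le xy0 mulr_ge0.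
have zero w w' : enorm w = 0 -> dotv w w' = 0.
  move=> w0; apply: big1 => i _; have := coord_le_enorm w i.
  by rewrite w0 normr_le0 => /eqP ->; rewrite mul0r.
move/eqP; rewrite mulf_eq0 => /orP[]/eqP z; rewrite /c.
  by rewrite zero // mulr_ge0.
by rewrite dotvC zero // mulr_ge0.
Qed.

Lemma ler_enormD u v : enorm (u + v) <= enorm u + enorm v.
Proof.
rewrite -(@ler_pXn2r _ 2) // ?nnegrE ?addr_ge0 ?enorm_ge0 //.
rewrite sqr_enorm !dotvE (dotvC v u) -!sqr_enorm.
have := dotv_cauchy u v; nra.
Qed.

Lemma continuous_enormB u : continuous (fun v => enorm (v - u)).
Proof.
move=> v; apply: (@continuous_comp _ _ _ (fun v => dotv (v - u) (v - u)) Num.sqrt);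
  last exact: sqrt_continuous.
apply: (@continuous_big _ _ +%R 0) => [x|i _].
  exact: add_continuous.
have c : continuous (fun w : 'rV[R]_d => (w - u) 0 i).
  move=> w; apply: (@continuous_comp _ _ _ (fun w : 'rV[R]_d => w - u) (fun M : 'rV[R]_d => M 0 i)).
    exact: (@cvgB R 'rV[R]_d _ (nbhs w) _ id (fun=> u) w u cvg_id (cvg_cst u)).
  exact: coord_continuous.
by move=> w; exact: (@cvgM R _ (nbhs w) _ _ _ _ _ (c w) (c w)).
Qed.

Variable D : set 'rV[R]_d.

(** [D] need not be bounded, so the distance is minimized on the compact part of [D] no farther from
    [y] than a fixed [w0]; all other points of [D] are worse than [w0]. *)
Lemma nearest_point_exists y : closed D -> D !=set0 ->
  exists x, D x /\ forall w, D w -> enorm (x - y) <= enorm (w - y).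
Proof.
move=> cD [w0 Dw0].
pose K := D `&` [set x | enorm (x - y) <= enorm (w0 - y)].
have cK : compact K.
  apply: bounded_closed_compact.
    exists (enorm (w0 - y) + `|y|); split; first exact: num_real.
    move=> M lM x [_ /= xy]; apply: le_trans (ltW lM).
    rewrite -[x](subrK y); apply: le_trans (ler_normD _ _) _; rewrite lerD2r.
    rewrite /Num.norm /= mx_normrE.
    apply/bigmax_leP; split => [|[i j] _ /=]; first exact: enorm_ge0.
    by rewrite ord1; apply: le_trans (coord_le_enorm _ _) xy.
  apply: closedI => //.
  exact: (iffLR (continuous_closedP _) (@continuous_enormB y) _ (@closed_le R (enorm (w0 - y)))).
have K0 : K !=set0 by exists w0; split => /=.
have [|x /set_mem[Dx /= xw0] xmin] := EVT_min_rV (f := fun x : 'rV[R]_d => enorm (x - y)) K0 cK.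
  by apply: continuous_subspaceT; apply: continuous_enormB.
exists x; split=> // w Dw; have [ww0|/ltW w0w] := leP (enorm (w - y)) (enorm (w0 - y)).
  by apply: xmin; rewrite inE.
exact: le_trans xw0 w0w.
Qed.

Lemma eproj_spec y : closed D -> D !=set0 ->
  D (eproj D y) /\ forall w, D w -> enorm (eproj D y - y) <= enorm (w - y).
Proof.
move=> cD D0.
exact: (@xgetPex _ y [set x | D x /\ forall w, D w -> enorm (x - y) <= enorm (w - y)]
  (nearest_point_exists y cD D0)).
Qed.

Lemma eproj_obtuse y w : is_convex_set D -> closed D -> D w ->
  dotv (y - eproj D y) (w - eproj D y) <= 0.
Proof.
move=> convD cD Dw.
have [|Dp pmin] := eproj_spec y cD; first by exists w.
set p := eproj D y in Dp pmin *; set c := dotv _ _; rewrite leNgt; apply/negP => c0.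
pose N := dotv (w - p) (w - p); have N0 : 0 <= N := dotvv_ge0 _.
(* Moving from [p] towards [w] by [l] changes the squared distance to [y] by - 2lc + l^2 N, which is
   negative once 0 < lN < 2c. This [l] satisfies lN < c and lies in [0, 1] without a case split on
   [N]. *)
pose l := c / (c + N).
have cN : 0 < c + N by lra.
have l01 : 0 <= l <= 1.
  by apply/andP; split; rewrite /l ?divr_ge0 ?ler_pdivrMr //; lra.
have := pmin _ (convD _ _ _ Dw Dp l01); rewrite ler_enorm.
have -> : l *: w + (1 - l) *: p - y = (p - y) + l *: (w - p).
  by apply/rowP => i; rewrite !mxE; ring.
have cE : dotv (p - y) (w - p) = - c by rewrite /c -dotvNl opprB.
move: cE; clearbody c; generalize (p - y) => a cE.
rewrite dotvDl !dotvDr !dotvZl !dotvZr (dotvC (w - p)) cE -/N.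
have : l * (c + N) = c by rewrite /l divfK // gt_eqF.
case/andP: l01; clearbody l N; nra.
Qed.

End Euclid.

(** * Directional derivatives and the Lipschitz condition on [D] *)

Section Gradient.
Context {R : realType} {d : nat}.
Variables (D : set 'rV[R]_d) (G : R).

Lemma derive_gradv (f : 'rV[R]_d -> R) (x v : 'rV[R]_d) :
  differentiable f x -> 'D_v f x = dotv v (gradv f x).
Proof.
move=> df; rewrite deriveE // {1}[v]row_sum_delta linear_sum; apply: eq_bigr => i _.
by rewrite linearZ /= mxE deriveE.
Qed.

(* Only differences of points of [D] are controlled: the gradient itself may be
   arbitrarily large in directions normal to [D]. *)
Lemma gradv_le_lipschitz (f : 'rV[R]_d -> R) (x y : 'rV[R]_d) :
  is_convex_set D -> D x -> D y -> differentiable f x -> glipschitz_on D G f ->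
  `|dotv (y - x) (gradv f x)| <= G * enorm (y - x).
Proof.
move=> convD Dx Dy df lipf; rewrite -derive_gradv //.
have /cvg_ex[l fl] : derivable f x (y - x) by exact: diff_derivable.
have -> : 'D_(y - x) f x = l by exact: cvg_lim fl.
(* The limit is taken from the right because convexity puts [x + h (y - x)] in [D] only for 0 <= h
   <= 1. *)
have {}fl : `|h^-1 *: ((f \o shift x) (h *: (y - x)) - f x)| @[h --> (0 : R)^'+] --> `|l|.
  by apply: cvg_norm; exact: cvg_dnbhs_at_right fl.
have <- := cvg_lim (@norm_hausdorff _ _) fl.
apply: limr_le; first exact: cvgP fl.
near=> h.
have h0 : 0 < h by near: h; exact: nbhs_right_gt.
have h1 : h <= 1 by near: h; exact: nbhs_right_le.
rewrite normrZ gtr0_norm ?invr_gt0 // ler_pdivrMl // mulrCA.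
have -> : h * enorm (y - x) = enorm (h *: (y - x)).
  by rewrite /enorm dotvZl dotvZr mulrA -expr2 sqrtrM ?sqr_ge0 // sqrtr_sqr gtr0_norm.
have Dz : D (h *: (y - x) + x).
  have -> : h *: (y - x) + x = h *: y + (1 - h) *: x.
    by rewrite scalerBl scale1r scalerBr addrAC -addrA.
  by apply: convD => //; rewrite h1 ltW.
by have := lipf _ _ Dz Dx; rewrite addrK.
Unshelve. all: by end_near. Qed.

End Gradient.

(** * Elementary bounds on the exponential *)

Section Scalar.
Context {R : realType}.
Implicit Types x y : R.

Lemma is_derive_ge0_le (g dg : R -> R) x :
  (forall t : R, is_derive t 1 g (dg t)) -> (forall t, 0 <= t -> 0 <= dg t) ->
  0 <= x -> g 0 <= g x.
Proof.
move=> gd dg0 x0; apply: (@ger0_derive1_ndecry _ g 0) => //.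
- by move=> t; rewrite in_itv /= andbT => /ltW /dg0; rewrite derive1E derive_val.
- apply: continuous_subspaceT => t.
  by apply: differentiable_continuous; apply/derivable1_diffP; apply: ex_derive.
Qed.

(** The right side times [expR y] is 1 at 0 and has the nonnegative derivative
    [y ^+ 2 / 2 * expR y]. *)
Lemma expRN_le_quad y : 0 <= y -> expR (- y) <= 1 - y + y ^+ 2 / 2.
Proof.
move=> y0.
pose g t : R := (1 - t + t ^+ 2 / 2) * expR t.
have gd (t : R) : is_derive t 1 g (t ^+ 2 / 2 * expR t).
  by apply: is_derive_eq; rewrite /GRing.scale /=; field.
have : g 0 <= g y.
  by apply: is_derive_ge0_le gd _ y0 => t _; rewrite mulr_ge0 ?expR_ge0 ?divr_ge0 ?sqr_ge0.
rewrite /g expr0n mul0r subr0 addr0 expR0 mulr1 expRN.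
by rewrite -ler_pdivrMr ?expR_gt0 // mul1r.
Qed.

Lemma expR_sub_sqr_le x : 0 <= x -> expR (x - x ^+ 2 / 2) <= 1 + x.
Proof.
move=> x0.
pose g t : R := (1 + t) * expR (t ^+ 2 / 2 - t).
have gd (t : R) : is_derive t 1 g (t ^+ 2 * expR (t ^+ 2 / 2 - t)).
  by apply: is_derive_eq; rewrite /GRing.scale /=; field.
have : g 0 <= g x.
  by apply: is_derive_ge0_le gd _ x0 => t _; rewrite mulr_ge0 ?expR_ge0 ?sqr_ge0.
rewrite /g expr0n mul0r subrr expR0 mulr1 addr0.
by rewrite -(opprB x) expRN -ler_pdivrMr ?invr_gt0 ?expR_gt0 // mul1r invrK.
Qed.

End Scalar.

(* Exp-concavity from first-order information only: [y] is the increment of the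
   loss, [s] its linearization and [n] the Lipschitz bound on both, all scaled
   by zeta; a Taylor bound in [s] alone fails for [s > 0]. *)
Lemma expRN_le_of_quad_gap {R : realType} (s y n : R) :
  s + n ^+ 2 / 2 <= y -> `|y| <= n -> `|s| <= n -> expR (- y) <= 1 - s.
Proof.
move=> sy; rewrite !ler_norml => /andP[yn1 yn2] /andP[sn1 sn2].
(* For y >= 0, the quadratic bound gives 1 - y + n^2/2 <= 1 - s. For y < 0, also s < 0, and - y <=
   (- s) - s^2/2, so the second exponential bound applies at - s. *)
have [y0|y0] := leP 0 y; first by have := expRN_le_quad y0; nra.
have n0 : 0 <= n by lra.
have := @expR_sub_sqr_le _ (- s) ltac:(nra).
apply: le_trans; rewrite ler_expR; nra.
Qed.

(** * Finite convex combinations and harmonic sums *)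

Lemma convex_sum {R : realType} {d : nat} (D : set 'rV[R]_d) (I : Type) (r : seq I)
    (w : I -> R) (x : I -> 'rV[R]_d) :
  is_convex_set D -> (forall i, 0 <= w i) -> (forall i, D (x i)) ->
  \sum_(i <- r) w i = 1 -> D (\sum_(i <- r) w i *: x i).
Proof.
move=> convD w0 Dx w1.
(* Tails of the list have total weight below 1, so the induction assigns the missing mass to an
   arbitrary point [y] of [D]; the head is then absorbed into that point. *)
suff gen y : D y -> \sum_(i <- r) w i <= 1 ->
    D (\sum_(i <- r) w i *: x i + (1 - \sum_(i <- r) w i) *: y).
  case: r w1 gen => [|i r] w1 gen.
    by move: w1; rewrite big_nil => /eqP; rewrite eq_sym oner_eq0.
  by have := gen _ (Dx i); rewrite w1 subrr scale0r addr0 lexx; exact.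
elim: r {w1} y => [|i r IH] y Dy.
  by rewrite !big_nil subr0 add0r scale1r.
rewrite !big_cons => w1; set S := \sum_(j <- r) w j in w1 IH *.
have wi0 := w0 i.
have [c0|c0] := ltP 0 (1 - S).
  pose y' := (w i / (1 - S)) *: x i + (1 - w i / (1 - S)) *: y.
  have Dy' : D y'.
    apply: convD => //; apply/andP; split; first by rewrite divr_ge0 // ltW.
    by rewrite ler_pdivrMr // mul1r; lra.
  have := IH y' Dy' ltac:(lra); congr D.
  rewrite [RHS]addrAC [RHS]addrC; congr (_ + _).
  rewrite /y' scalerDr !scalerA mulrBr mulr1 mulrCA divff ?gt_eqF // mulr1.
  by rewrite opprD addrA addrAC.
have wi : w i = 0 by lra.
by rewrite wi scale0r !add0r; apply: IH => //; lra.
Qed.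

(** The induction step is ln(1 - 1/m) <= - 1/m. The case n = 0 relies on the convention that [ln 0]
    is 0. *)
Lemma sum_inv_le_ln {R : realType} n :
  \sum_(k < n) (k.+1%:R : R)^-1 <= 1 + ln n%:R.
Proof.
case: n => [|n]; first by rewrite big_ord0 ln0 ?addr0.
elim: n => [|n IH]; first by rewrite big_ord_recl big_ord0 /= invr1 ln1.
rewrite big_ord_recr /=; apply: le_trans (lerD IH (lexx _)) _.
rewrite -addrA lerD2l.
have n0 m : 0 < m.+1%:R :> R by rewrite ltr0n.
have -> : n.+1%:R = n.+2%:R * (1 + - n.+2%:R^-1) :> R.
  by rewrite mulrDr mulr1 mulrN divff ?gt_eqF // -(natr1 n.+1) addrK.
have h : 0 < 1 + - n.+2%:R^-1 :> R.
  by rewrite subr_gt0 invf_lt1 // ltr1n.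
rewrite lnM ?posrE // -addrA gerDl -lerBrDr sub0r; apply: le_ln1Dx.
by rewrite ltrN2 invf_lt1 // ltr1n.
Qed.

(** * Exp-concavity and one projected gradient step for a single loss *)

Section Losses.
Context {R : realType} {d : nat}.
Variables (D : set 'rV[R]_d) (H G : R).
Hypotheses (H_gt0 : 0 < H) (G_gt0 : 0 < G).
Hypotheses (convD : is_convex_set D) (closedD : closed D).

Definition admissible (g : 'rV[R]_d -> R) :=
  (forall x, D x -> differentiable g x) /\ strongly_convex_on D H g /\ glipschitz_on D G g.

Lemma admissible_gradv_le g x y : admissible g -> D x -> D y ->
  `|dotv (y - x) (gradv g x)| <= G * enorm (y - x).
Proof. by move=> [dg [_ lg]] Dx Dy; apply: gradv_le_lipschitz lg => //; apply: dg. Qed.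

(** The choice of zeta enters here: with n = (H/G) |y - x|, scaling by H/G^2 turns the strong
    convexity gap into exactly n^2/2 and both Lipschitz bounds into n. *)
Lemma exp_concave_tangent g x y : admissible g -> D x -> D y ->
  expR (- zeta H G * (g y - g x)) <= 1 - zeta H G * dotv (y - x) (gradv g x).
Proof.
move=> adm Dx Dy; have [_ [sc lg]] := adm.
have z0 : 0 < zeta H G by rewrite divr_gt0 ?exprn_gt0.
have zG : zeta H G * G = H / G by rewrite /zeta expr2 invfM mulrA mulfVK ?gt_eqF.
rewrite mulNr; apply: (@expRN_le_of_quad_gap _ _ _ (H / G * enorm (y - x))).
- have -> : (H / G * enorm (y - x)) ^+ 2 / 2 = zeta H G * (H / 2 * enorm (x - y) ^+ 2).
    by rewrite enormB /zeta; field; rewrite gt_eqF.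
  rewrite -mulrDr ler_pM2l // lerBrDl addrA; exact: sc.
- by rewrite normrM gtr0_norm // -zG -mulrA ler_pM2l // enormB distrC lg.
- by rewrite normrM gtr0_norm // -zG -mulrA ler_pM2l // admissible_gradv_le.
Qed.

(** Jensen's inequality, obtained by averaging the tangent bounds at the weighted mean, where the
    linear terms cancel. *)
Lemma exp_concave_sum (I : Type) (r : seq I) (w : I -> R) (x : I -> 'rV[R]_d) g :
  admissible g -> (forall i, 0 <= w i) -> (forall i, D (x i)) ->
  \sum_(i <- r) w i = 1 ->
  \sum_(i <- r) w i * expR (- zeta H G * g (x i)) <=
    expR (- zeta H G * g (\sum_(i <- r) w i *: x i)).
Proof.
move=> adm w0 Dx w1; set xb := \sum_(i <- r) w i *: x i.
have Dxb : D xb by exact: convex_sum.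
have : \sum_(i <- r) w i * expR (- zeta H G * (g (x i) - g xb)) <= 1.
  apply: (@le_trans _ _ (\sum_(i <- r) w i * (1 - zeta H G * dotv (x i - xb) (gradv g xb)))).
    by apply: ler_sum => i _; rewrite ler_wpM2l // exp_concave_tangent.
  under eq_bigr do rewrite mulrBr mulr1 mulrCA dotvC dotvDr dotvNr mulrBr -dotvZr.
  rewrite sumrB w1 -mulr_sumr sumrB -dotv_sumr -mulr_suml w1 mul1r subrr mulr0 subr0.
  exact: lexx.
rewrite -(ler_pM2r (expR_gt0 (- zeta H G * g xb))) mul1r mulr_suml.
by under eq_bigr do rewrite -mulrA -expRD -mulrDr subrK.
Qed.

(** Nonexpansiveness of the projection would leave the uncontrolled norm of [v]. The obtuse angle at
    the projection p instead pairs [v] only with x - p and keeps a term - |x - p|^2; completing the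
    square gives eta^2 G^2. *)
Lemma projected_step_le (x u v : 'rV[R]_d) (eta : R) : 0 <= eta -> D x -> D u ->
  (forall y, D y -> `|dotv (y - x) v| <= G * enorm (y - x)) ->
  enorm (eproj D (x - eta *: v) - u) ^+ 2 <=
    enorm (x - u) ^+ 2 - 2 * eta * dotv (x - u) v + eta ^+ 2 * G ^+ 2.
Proof.
move=> eta0 Dx Du vG.
have := @eproj_obtuse _ _ _ (x - eta *: v) _ convD closedD Du.
have [|Dp _] := @eproj_spec _ _ _ (x - eta *: v) closedD; first by exists x.
have := vG _ Dp; move: (eproj _ _) Dp => p Dp; rewrite ler_norml => /andP[+ _].
have -> : p - u = (x - u) - (x - p) by apply/rowP => i; rewrite !mxE; ring.
have -> : x - eta *: v - p = (x - p) - eta *: v by apply/rowP => i; rewrite !mxE; ring.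
have -> : u - p = (x - p) - (x - u) by apply/rowP => i; rewrite !mxE; ring.
rewrite (enormB p) -(opprB x p); move: (x - p) (x - u) => b a.
rewrite dotvNl lerN2 sqr_enorm !dotvE (dotvC a b) (dotvC v) (dotvC v) -!sqr_enorm.
move: (enorm b) => e vb ob; have := ler_wpM2l eta0 vb.
have := sqr_ge0 (e - eta * G); move: (dotv b a) (dotv a v) (dotv b v) ob => ba av bv ob.
move: (enorm a) => ea; nra.
Qed.

End Losses.

(** * Static regret of the base learners *)

Section Learners.
Context {R : realType} {d : nat}.
Variables (D : set 'rV[R]_d) (H G : R).
Hypotheses (H_gt0 : 0 < H) (G_gt0 : 0 < G).
Hypotheses (convD : is_convex_set D) (closedD : closed D).
Variables (f : nat -> 'rV[R]_d -> R) (init : nat -> 'rV[R]_d).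
Hypothesis Dinit : forall j, D (init j).

Notation x := (ogd D H f init).
Notation e := (base D H f init).
Notation p := (flh_w D H G f init).
Notation admissible := (admissible D H G).

Lemma ogd_in j n : D (x j n).
Proof.
case: n => [|n] //=; set y := (_ - _).
by have [|] := @eproj_spec _ _ _ y closedD; first by exists (init j).
Qed.

(** Step 1/(H(n+1)) gives both squared distances the weight n+1, and strong convexity lowers the
    first to n. The sum over n telescopes from weight 0, so neither the diameter of [D] nor the
    initial distance enters. *)
Lemma ogd_step_regret j n u : D u -> admissible (f (j + n)%N) ->
  f (j + n)%N (x j n) - f (j + n)%N u <=
    H / 2 * (n%:R * enorm (x j n - u) ^+ 2 - n.+1%:R * enorm (x j n.+1 - u) ^+ 2)
    + G ^+ 2 / (2 * H) * n.+1%:R^-1.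
Proof.
move=> Du adm; have Dx := ogd_in j n; have [_ [sc _]] := adm.
have k0 : 0 < n.+1%:R :> R by rewrite ltr0n.
have eta0 : 0 <= (H * n.+1%:R)^-1 by rewrite invr_ge0 mulr_ge0 // ltW.
have := projected_step_le convD closedD eta0 Dx Du
  (fun y Dy => admissible_gradv_le convD adm Dx Dy).
have := sc _ _ Dx Du.
rewrite -(opprB (x j n) u) dotvNl -[eproj _ _]/(x j n.+1).
move: (enorm (x j n - u) ^+ 2) (enorm (x j n.+1 - u) ^+ 2) (dotv _ _) => a b c h1 h2.
have := ler_wpM2l (ltW (mulr_gt0 (divr_gt0 H_gt0 (ltr0Sn R 1)) k0)) h2.
have -> : H / 2 * n.+1%:R * (a - 2 * (H * n.+1%:R)^-1 * c + (H * n.+1%:R)^-1 ^+ 2 * G ^+ 2)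
   = H / 2 * n.+1%:R * a - c + G ^+ 2 / (2 * H) * n.+1%:R^-1.
  by field; rewrite !gt_eqF.
move: (G ^+ 2 / _ / _) => g; rewrite -(natr1 n); nra.
Qed.

Lemma ogd_regret j n u : D u ->
  (forall k, (k < n)%N -> admissible (f (j + k)%N)) ->
  \sum_(k < n) (f (j + k)%N (x j k) - f (j + k)%N u) <=
    G ^+ 2 / (2 * H) * (1 + ln n%:R).
Proof.
move=> Du adm.
(* With step 1/(H k), the terms [k * |x_k - u|^2] telescope. *)
suff telescoped : \sum_(k < n) (f (j + k)%N (x j k) - f (j + k)%N u)
    + H / 2 * (n%:R * enorm (x j n - u) ^+ 2) <= G ^+ 2 / (2 * H) * \sum_(k < n) k.+1%:R^-1.
  have c0 : 0 <= G ^+ 2 / (2 * H) by rewrite divr_ge0 ?sqr_ge0 // mulr_ge0 // ltW.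
  apply: le_trans (ler_wpM2l c0 (sum_inv_le_ln n)).
  apply: le_trans telescoped; rewrite lerDl.
  by apply: mulr_ge0; [rewrite divr_ge0 // ltW|rewrite mulr_ge0 // sqr_ge0].
elim: n adm => [|n IH] adm; first by rewrite !big_ord0 mul0r mulr0 addr0 mulr0.
rewrite !big_ord_recr mulrDr /=.
have := IH (fun k kn => adm k (ltnW kn)).
have := ogd_step_regret Du (adm n (ltnSn n)); rewrite -[eproj _ _]/(x j n.+1).
move: (\sum_(k < n) _) (\sum_(k < n) _) (G ^+ 2 / _) => S S' g.
move: (n%:R * _) (n.+1%:R * _) (g / _) => A B h; lra.
Qed.

(** * FLH weights and regret on intervals *)

Definition mixture s := \sum_(1 <= j < s.+1) p s j * expR (- zeta H G * f s (e j s)).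

Lemma flh_wS s i : (0 < s)%N ->
  p s.+1 i = if i == s.+1 then s.+1%:R^-1 else if (1 <= i <= s)%N then
      (1 - s.+1%:R^-1) * (p s i * expR (- zeta H G * f s (e i s)) / mixture s) else 0.
Proof. by case: s. Qed.

Lemma flh_w_ge0 s i : 0 <= p s i.
Proof.
elim: s i => [|[|s] IH] i //; first by rewrite /=; case: ifP.
rewrite flh_wS //; case: ifP => _; first by rewrite invr_ge0.
case: ifP => _ //; rewrite mulr_ge0 ?subr_ge0 ?invf_le1 ?ler1n ?ltr0n //.
rewrite !mulr_ge0 ?invr_ge0 ?expR_ge0 //.
by apply: sumr_ge0 => j _; rewrite mulr_ge0 ?expR_ge0.
Qed.

Lemma mixture_gt0 s : \sum_(1 <= j < s.+1) p s j = 1 -> 0 < mixture s.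
Proof.
move=> p1; have t0 j : 0 <= p s j * expR (- zeta H G * f s (e j s)).
  by rewrite mulr_ge0 ?expR_ge0 ?flh_w_ge0.
rewrite lt_def sumr_ge0 // andbT psumr_eq0 //; apply/negP => z.
suff : \sum_(1 <= j < s.+1) p s j == 0 by rewrite p1 oner_eq0.
rewrite psumr_eq0; last by move=> j _; exact: flh_w_ge0.
by apply: sub_all z => j /=; rewrite mulf_eq0 (gt_eqF (expR_gt0 _)) orbF.
Qed.

Lemma flh_w_sum s : (0 < s)%N -> \sum_(1 <= j < s.+1) p s j = 1.
Proof.
elim: s => [|[|s] IH] // _; first by rewrite big_nat1.
have {}IH := IH isT; rewrite big_nat_recr // flh_wS // eqxx.
rewrite (eq_big_nat _ _ (F2 := fun i => (1 - s.+2%:R^-1) / mixture s.+1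
    * (p s.+1 i * expR (- zeta H G * f s.+1 (e i s.+1))))); last first.
  move=> i /andP[i1 i2]; rewrite flh_wS // ltn_eqF // i1 /= -ltnS i2.
  by rewrite -[RHS]mulrA (mulrC (mixture _)^-1).
rewrite -mulr_sumr -/(mixture s.+1) divfK /=; first by rewrite subrK.
by rewrite gt_eqF // mixture_gt0.
Qed.

Lemma base_in j t : D (e j t).
Proof. exact: ogd_in. Qed.

(** The potential t v_t^(a) starts at 1 when t = a. In each round the factor t+1 turns the mixing
    factor 1 - 1/(t+1) into t, and Jensen bounds the normalizer by the exponential of the loss of
    FLH. *)
Lemma flh_w_lower a n : (0 < a)%N -> (forall t, (a <= t < a + n)%N -> admissible (f t)) ->
  expR (zeta H G * \sum_(a <= t < a + n) (f t (flh_x D H G f init t) - f t (e a t)))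
    <= (a + n)%:R * p (a + n)%N a.
Proof.
move=> a0; elim: n => [_|n IH adm].
  rewrite addn0 big_geq // mulr0 expR0.
  case: a a0 => [//|[|a]] _; first by rewrite /= mulr1.
  by rewrite flh_wS // eqxx divff // pnatr_eq0.
have /IH {}IH : forall t, (a <= t < a + n)%N -> admissible (f t).
  by move=> t /andP[t1 t2]; apply: adm; rewrite t1 addnS ltnW.
have an0 : (0 < a + n)%N by rewrite addn_gt0 a0.
have pan : \sum_(1 <= j < (a + n).+1) p (a + n)%N j = 1 by exact: flh_w_sum.
have Z0 := mixture_gt0 pan.
have admn : admissible (f (a + n)%N) by apply: adm; rewrite leq_addr addnS ltnSn.
have := exp_concave_sum H_gt0 G_gt0 convD admn (flh_w_ge0 (a + n))
  (fun j => base_in j (a + n)) pan.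
rewrite -/(mixture _) -/(flh_x D H G f init (a + n)) => jensen.
rewrite addnS flh_wS // ltn_eqF ?ltnS ?leq_addr // a0.
rewrite big_nat_recr ?leq_addr //= mulrDr expRD mulrBr expRD.
have -> : (a + n).+1%:R * ((1 - (a + n).+1%:R^-1) * (p (a + n)%N a
    * expR (- zeta H G * f (a + n)%N (e a (a + n))) / mixture (a + n)))
  = ((a + n)%:R * p (a + n)%N a)
    * ((mixture (a + n))^-1 * expR (- zeta H G * f (a + n)%N (e a (a + n)))).
  by rewrite -(natr1 (a + n)); field; rewrite gt_eqF //=.
apply: ler_pM; rewrite ?expR_ge0 ?mulr_ge0 ?expR_ge0 //.
rewrite -mulNr ler_pM2r ?expR_gt0 // -[leLHS]invrK lef_pV2 ?posrE ?invr_gt0 ?expR_gt0 //.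
by rewrite -expRN -mulNr.
Qed.

Lemma flh_regret a b : (0 < a <= b)%N -> (forall t, (a <= t < b)%N -> admissible (f t)) ->
  \sum_(a <= t < b) (f t (flh_x D H G f init t) - f t (e a t)) <= G ^+ 2 / H * ln b%:R.
Proof.
move=> /andP[a0 ab]; have b0 : (0 < b)%N by exact: leq_trans ab.
rewrite -(subnKC ab) => /(flh_w_lower a0); rewrite subnKC // => lower.
have pb1 : p b a <= 1.
  rewrite -(flh_w_sum b0) (bigD1_seq a) ?mem_index_iota ?iota_uniq ?a0 ?ltnS //=.
  by rewrite lerDl sumr_ge0 // => j _; exact: flh_w_ge0.
have := le_trans lower (ler_wpM2l (ler0n _ _) pb1); rewrite mulr1.
rewrite -ler_ln ?posrE ?expR_gt0 ?ltr0n // expRK.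
have z0 : 0 < zeta H G by rewrite divr_gt0 ?exprn_gt0.
by rewrite -ler_pdivlMl // /zeta invf_div.
Qed.

Lemma interval_regret (T a b : nat) u : (0 < a <= b)%N -> (b <= T.+1)%N -> D u ->
  (forall t, (1 <= t <= T)%N -> admissible (f t)) ->
  \sum_(a <= t < b) (f t (flh_x D H G f init t) - f t u)
    <= 3 / 2 * (G ^+ 2 / H) * (1 + ln T%:R).
Proof.
move=> /andP[a0 ab] bT Du adm.
have c0 : 0 < G ^+ 2 / H by rewrite divr_gt0 ?exprn_gt0.
(* When T = 0 the bounds force a = b = 1, an empty interval. *)
have T0 : (0 < T)%N \/ (a = b).
  by lia.
have lnT0 : 0 <= ln (T%:R : R).
  by case: (T) => [|n]; [rewrite ln0|rewrite ln_ge0 // ler1n].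
case: T0 => [T0|<-]; last first.
  by rewrite big_geq // mulr_ge0 ?addr_ge0 // ltW // mulr_gt0.
have T0' : 0 < T%:R :> R by rewrite ltr0n.
have admb t : (a <= t < b)%N -> admissible (f t) by move=> ?; apply: adm; lia.
have flh := flh_regret (a := a) (b := b) (introT andP (conj a0 ab)) admb.
have ogd := @ogd_regret a (b - a) u Du ltac:(move=> k kb; apply: adm; lia).
have -> : \sum_(a <= t < b) (f t (flh_x D H G f init t) - f t u) =
   \sum_(a <= t < b) (f t (flh_x D H G f init t) - f t (e a t))
   + \sum_(k < b - a) (f (a + k)%N (x a k) - f (a + k)%N u).
  have -> : \sum_(k < b - a) (f (a + k)%N (x a k) - f (a + k)%N u)
     = \sum_(a <= t < b) (f t (e a t) - f t u).
    transitivity (\sum_(0 + a <= t < b) (f t (e a t) - f t u)); last by rewrite add0n.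
    rewrite big_addn big_mkord; apply: eq_bigr => k _.
    by rewrite /base addnK addnC.
  by rewrite -big_split; apply: eq_bigr => t _ /=; rewrite addrA subrK.
(* The excluded endpoint [b] may be T + 1, and ln(1 + 1/T) <= 1 pays for it. The factor 3/2 is then
   1 from FLH plus 1/2 from the base learner. *)
have lnb : ln (b%:R : R) <= 1 + ln T%:R.
  have bTS : b%:R <= T.+1%:R :> R by rewrite ler_nat.
  apply: le_trans (_ : ln T.+1%:R <= _).
    by rewrite ler_ln ?posrE ?ltr0n //; lia.
  have -> : T.+1%:R = T%:R * (1 + T%:R^-1) :> R.
    by rewrite mulrDr mulr1 divff ?gt_eqF // natr1.
  rewrite lnM ?posrE ?addr_gt0 ?invr_gt0 // addrC lerD2r.
  apply: le_trans (le_ln1Dx _) _; first by rewrite (lt_trans _ (_ : 0 < _)) ?invr_gt0.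
  by rewrite invf_le1 // ler1n.
have lnba : ln ((b - a)%:R : R) <= ln T%:R.
  have [->|ba] := posnP (b - a); first by rewrite ln0.
  by rewrite ler_ln ?posrE ?ltr0n // ler_nat; lia.
have h : G ^+ 2 / (2 * H) = G ^+ 2 / H / 2 by rewrite invfM mulrA mulrAC.
rewrite h in ogd; apply: le_trans (lerD flh ogd) _.
move: (G ^+ 2 / H) (ln _) (ln _) (ln _) c0 lnb lnba => c L Lb Lba; nra.
Qed.

End Learners.

(** * From static regret on intervals to dynamic regret *)

Section Blocks.
Context {R : realType} {d : nat}.
Variable z : nat -> 'rV[R]_d.

(* The bound [b] is excluded: this is the length of z_a, ..., z_(b-1). *)
Definition path_variation a b := \sum_(a.+1 <= s < b) enorm (z s - z s.-1).

Lemma path_variation_ge0 a b : 0 <= path_variation a b.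
Proof. by apply: sumr_ge0 => s _; exact: enorm_ge0. Qed.

Lemma path_variation_le_right a b c : (b <= c)%N -> path_variation a b <= path_variation a c.
Proof.
move=> bc; have [ab|ba] := leqP a.+1 b.
  rewrite /path_variation (big_cat_nat ab bc) /= lerDl.
  by apply: sumr_ge0 => s _; exact: enorm_ge0.
by rewrite {1}/path_variation big_geq ?path_variation_ge0 // ltnW.
Qed.

(** For a < c < b the jump from [z c.-1] to [z c] is counted in neither block, hence an
    inequality. *)
Lemma path_variation_split a c b : (a <= c <= b)%N ->
  path_variation a c + path_variation c b <= path_variation a b.
Proof.
move=> /andP[]; rewrite leq_eqVlt => /orP[/eqP <- _|ac cb].
  by rewrite {1}/path_variation big_geq // add0r.
rewrite [leRHS]/path_variation (big_cat_nat ac cb) /= lerD2l.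
move: cb; rewrite leq_eqVlt => /orP[/eqP ->|cb]; first by rewrite /path_variation !big_geq.
by rewrite [leRHS]big_ltn // lerDr enorm_ge0.
Qed.

Lemma enorm_le_path_variation a n : enorm (z a - z (a + n)%N) <= path_variation a (a + n).+1.
Proof.
elim: n => [|n IH]; first by rewrite addn0 subrr enorm0 path_variation_ge0.
rewrite /path_variation big_nat_recr /=; last by rewrite addnS ltnS leq_addr.
rewrite -[X in enorm X](subrKA (z (a + n)%N)) addnS /=.
apply: le_trans (ler_enormD _ _) _; rewrite (enormB (z (a + n)%N)).
by rewrite lerD2r.
Qed.

(** A block of up to l + 1 rounds costs only the factor l because the term t = a vanishes. *)
Lemma block_drift a c l : (a <= c <= a + l.+1)%N ->
  \sum_(a <= t < c) enorm (z a - z t) <= l%:R * path_variation a c.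
Proof.
move=> /andP[ac cl]; have := path_variation_ge0 a c.
move: ac; rewrite leq_eqVlt => /orP[/eqP <- v0|ac v0].
  by rewrite big_geq // mulr_ge0.
rewrite big_ltn // subrr enorm0 add0r.
apply: (@le_trans _ _ (\sum_(a.+1 <= t < c) path_variation a c)).
  apply: ler_sum_nat => t /andP[at_ tc].
  rewrite -(subnKC (ltnW at_)); apply: le_trans (enorm_le_path_variation _ _) _.
  by apply: path_variation_le_right; rewrite subnKC // ltnW.
rewrite sumr_const_nat -[leLHS]mulr_natl ler_wpM2r // ler_nat; lia.
Qed.

Variables (D : set 'rV[R]_d) (G B : R) (f : nat -> 'rV[R]_d -> R) (loss : nat -> R) (T : nat).
Hypotheses (G_ge0 : 0 <= G) (B_ge0 : 0 <= B) (Dz : forall t, (1 <= t <= T)%N -> D (z t)).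
Hypothesis lipf : forall t, (1 <= t <= T)%N -> glipschitz_on D G (f t).
Hypothesis static : forall a b u, (0 < a <= b)%N -> (b <= T.+1)%N -> D u ->
  \sum_(a <= t < b) (loss t - f t u) <= B.

(** Induction on the number of blocks: freezing the comparator at the start of a block costs [B]
    plus G times the drift, and the drifts add up by superadditivity of [path_variation]. *)
Lemma dynamic_regret_of_static q l a b :
  (0 < a <= b)%N -> (b <= T.+1)%N -> (b <= a + q * l.+1)%N ->
  \sum_(a <= t < b) (loss t - f t (z t)) <= q%:R * B + G * (l%:R * path_variation a b).
Proof.
elim: q a => [|q IH] a /andP[a0 ab] bT bq.
  rewrite big_geq ?mul0r ?add0r; last by rewrite mul0n addn0 in bq.
  by rewrite !mulr_ge0 ?path_variation_ge0.
have [<-|neab] := eqVneq a b.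
  by rewrite big_geq // addr_ge0 // !mulr_ge0 ?path_variation_ge0.
(* The last block may be shorter than l + 1. *)
pose c := minn (a + l.+1) b.
have ac : (a <= c)%N by rewrite /c; lia.
have cb : (c <= b)%N by rewrite /c; lia.
have cl : (c <= a + l.+1)%N by rewrite /c; lia.
have bc : (b <= c + q * l.+1)%N by rewrite /c; lia.
have aT : (1 <= a <= T)%N by lia.
have first_block : \sum_(a <= t < c) (loss t - f t (z t)) <= B + G * (l%:R * path_variation a c).
  apply: (@le_trans _ _ (\sum_(a <= t < c) (loss t - f t (z a))
      + G * \sum_(a <= t < c) enorm (z a - z t))).
    rewrite mulr_sumr -big_split; apply: ler_sum_nat => t /andP[at_ tc] /=.
    rewrite -[leLHS](subrKA (f t (z a))) lerD2l; apply: le_trans (ler_norm _) _.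
    by apply: lipf; [|exact: Dz|apply: Dz]; lia.
  apply: lerD; first by apply: static; [lia|lia|exact: Dz].
  by rewrite ler_wpM2l // block_drift // ac.
have rest := IH c ltac:(lia) bT bc.
rewrite (big_cat_nat ac cb) /=; apply: le_trans (lerD first_block rest) _.
rewrite -natr1 mulrDl mul1r addrACA addrC [leLHS]addrC (addrC B) lerD2l -mulrDr ler_wpM2l //.
by rewrite -mulrDr ler_wpM2l // path_variation_split // ac.
Qed.

End Blocks.

(** * Tuning the block length to the path length *)

Theorem theorem4 (R : realType) (H G : R) :
  0 < H -> 0 < G ->
  exists (C : R) (k : nat),
  forall (d : nat) (D : set 'rV[R]_d) (f : nat -> 'rV[R]_d -> R)
         (init : nat -> 'rV[R]_d) (z : nat -> 'rV[R]_d) (T : nat),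
    is_convex_set D -> closed D ->
    (forall j, D (init j)) ->
    (forall t, (1 <= t <= T)%N ->
       (forall x, D x -> differentiable (f t) x) /\
       strongly_convex_on D H (f t) /\ glipschitz_on D G (f t)) ->
    (forall t, (1 <= t <= T)%N -> D (z t)) ->
    regret D H G f init z T <=
      C * (1 + ln T%:R) ^+ k * Num.max (Num.sqrt (T%:R * path_length z T)) 1.
Proof.
(* At most 2M blocks at 3/2 (G^2/H)(1 + ln T) each give the first term; the drift G M, multiplied by
   1 + ln T >= 1, gives the second. *)
move=> H0 G0; exists (3 * (G ^+ 2 / H) + G), 1%N => d D f init z T convD cD Dinit adm Dz.
have lnT0 : 0 <= ln (T%:R : R).
  by case: (T) => [|n]; [rewrite ln0|rewrite ln_ge0 // ler1n].
have c0 : 0 < G ^+ 2 / H by rewrite divr_gt0 ?exprn_gt0.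
pose B := 3 / 2 * (G ^+ 2 / H) * (1 + ln (T%:R : R)).
have B0 : 0 <= B by rewrite mulr_ge0 ?addr_ge0 // ltW // mulr_gt0.
rewrite expr1 -[path_length z T]/(path_variation z 1 T.+1).
set V := path_variation z 1 T.+1; have V0 : 0 <= V := path_variation_ge0 _ _ _.
set M := Num.max _ _.
have M1 : 1 <= M by rewrite le_max lexx orbT.
have M0 : 0 < M by exact: lt_le_trans M1.
have TVM : T%:R * V <= M ^+ 2.
  rewrite -[leLHS]sqr_sqrtr ?mulr_ge0 // ler_pXn2r ?nnegrE ?sqrtr_ge0 ?(ltW M0) //.
  by rewrite le_max lexx.
(* With l the integer part of T/M, blocks have length l + 1 > T/M, so their number is at most M + 1
   <= 2M, while the drift only involves l <= T/M and l V <= M. The path length enters only this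
   analysis, not the algorithm. *)
have /truncn_itv : 0 <= T%:R / M by rewrite divr_ge0 // ltW.
set l := Num.truncn _ => /andP[lM Ml].
pose q := (T %/ l.+1).+1.
have bq : (T.+1 <= 1 + q * l.+1)%N by rewrite add1n ltnS ltnW // ltn_ceil.
have static a b u : (0 < a <= b)%N -> (b <= T.+1)%N -> D u ->
    \sum_(a <= t < b) (f t (flh_x D H G f init t) - f t u) <= B.
  by move=> ab bT Du; exact: interval_regret.
have := dynamic_regret_of_static (ltW G0) B0 Dz (fun t tT => (adm t tT).2.2) static
  (isT : (0 < 1 <= T.+1)%N) (leqnn _) bq.
rewrite -/(regret D H G f init z T) -/V => /le_trans; apply.
have qM : q%:R <= 2 * M.
  suff : (T %/ l.+1)%:R <= M by rewrite /q -natr1; lra.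
  rewrite -(ler_pM2r (ltr0Sn R l)) -natrM.
  apply: (@le_trans _ _ T%:R); first by rewrite ler_nat leq_trunc_div.
  by rewrite mulrC -ler_pdivrMr // ltW.
have lV : l%:R * V <= M.
  apply: (@le_trans _ _ (T%:R / M * V)); first exact: ler_wpM2r.
  by rewrite mulrAC ler_pdivrMr // -expr2.
have := ler_wpM2r B0 qM; have := ler_wpM2l (ltW G0) lV.
rewrite /B; move: (G ^+ 2 / H) (ln _) (l%:R * V) c0 lnT0 => c L W c0 L0 h1 h2.
apply: le_trans (lerD h2 h1) _.
have : 0 <= G * L * M by rewrite !mulr_ge0 // ltW.
lra.
Qed.
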